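(* For all integers $r\geq 4$, $H_{4, 4^r}$ is a Ramanujan graph of degree $2^{r+1}-2$ with $4^r$ vertices. Moreover, all eigenvalues of $H_{4,4^r}$ except for the degree are in the interval $[-2^{r/2+1}-2,\; 2^{r/2+1}+2]$.
   Context: For an integer $r\ge 1$, the Galois ring of characteristic $4$ and order $4^r$ is $GR(4,4^r) := \mathbb{Z}_4[x]/(f(x))$, where $\mathbb{Z}_4=\mathbb{Z}/4\mathbb{Z}$ and $f(x)\in\mathbb{Z}_4[x]$ is a monic polynomial of degree $r$ whose reduction modulo $2$ is irreducible over $\mathbb{Z}_2$ (up to isomorphism, the ring does not depend on $f$). $GR^+(4,4^r)$ and $GR^*(4,4^r)$ denote its additive group and its group of units. $GR^*(4,4^r)$ contains a unique subgroup $G_1$ of order $2^r-1$, which is cyclic. For an additively written group $\Gamma$ and $S\subset\Gamma\setminus\{0\}$ with $S=-S$, the Cayley graph $Cay(\Gamma,S)$ has vertex set $\Gamma$, with $x,y$ adjacent if and only if $x-y\in S$. For $r\ge 2$ define $H_{4,4^r} := Cay(GR^+(4,4^r), G_1\cup -G_1)$. Eigenvalues of a graph are the eigenvalues of its adjacency matrix. For a $d$-regular graph $G$, $\lambda(G)$ is the largest absolute value of the eigenvalues of $G$ other than $\pm d$, and $G$ is called a Ramanujan graph if $\lambda(G)\le 2\sqrt{d-1}$. *)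

(* Defs.v *)
From HB Require Import structures.
From mathcomp Require Import all_boot all_order all_fingroup all_algebra.

Set Implicit Arguments.
Unset Strict Implicit.
Unset Printing Implicit Defensive.

Import GRing.Theory Num.Theory.
Local Open Scope ring_scope.

Definition red2 (a : 'Z_4) : 'F_2 := (a : nat)%:R.

Definition galois_poly (r : nat) (f : {poly 'Z_4}) : Prop :=
  [/\ f \is monic, size f = r.+1 & irreducible_poly (map_poly red2 f)].

(* GR(4, 4^r) when galois_poly r f holds. The alias is needed because the
   library gives {poly %/ f} inverses only over a field of coefficients. Here
   the finite-ring factory takes as units exactly the elements that have a
   two-sided inverse. *)
Definition GR (f : {poly 'Z_4}) : Type := {poly %/ f}.

HB.instance Definition _ (f : {poly 'Z_4}) := Finite.on (GR f).
HB.instance Definition _ (f : {poly 'Z_4}) := GRing.ComNzRing.on (GR f).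
HB.instance Definition _ (f : {poly 'Z_4}) := FinRing.isNzRing.Build (GR f).

(* The unique subgroup of order 2^r - 1 of the group of units. The default value
   of odflt is not used when galois_poly r f holds, since then such a subgroup
   exists. *)
Definition G1 (r : nat) (f : {poly 'Z_4}) : {group {unit GR f}} :=
  odflt 1%G [pick G : {group {unit GR f}} | #|G| == (2 ^ r - 1)%N].

Record sgraph := SGraph {
  vertex : finType;
  adj : rel vertex;
  adj_sym : symmetric adj;
  adj_irrefl : irreflexive adj }.

Definition regular (G : sgraph) (d : nat) : Prop :=
  forall x : vertex G, #|[set y | adj x y]| = d.

Definition adjmx (C : numClosedFieldType) (G : sgraph) :
    'M[C]_(#|vertex G|) :=
  \matrix_(i, j) (adj (enum_val i) (enum_val j))%:R.

(* lambda(G) = l. This is false for every l when d and -d are the only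
   eigenvalues, as for K_2, where there is no largest value to take. *)
Definition is_lambda (C : numClosedFieldType) (G : sgraph) (d : nat) (l : C) :
    Prop :=
  (exists mu : C, [/\ eigenvalue (adjmx C G) mu, mu != d%:R, mu != - d%:R
                    & l = `|mu|]) /\
  (forall mu : C, eigenvalue (adjmx C G) mu -> mu != d%:R -> mu != - d%:R ->
     `|mu| <= l).

Definition ramanujan (C : numClosedFieldType) (G : sgraph) (d : nat) : Prop :=
  regular G d /\
  exists2 l : C, is_lambda G d l & l <= 2 * sqrtC (d%:R - 1).

Section Cayley.

Variables (V : finZmodType) (S : {set V}).
Hypotheses (S0 : 0 \notin S) (SN : forall x, (- x \in S) = (x \in S)).

Definition cayley_adj : rel V := fun x y => x - y \in S.

Lemma cayley_sym : symmetric cayley_adj.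
Proof. by move=> x y; rewrite /cayley_adj -SN opprB. Qed.

Lemma cayley_irrefl : irreflexive cayley_adj.
Proof. by move=> x; rewrite /cayley_adj subrr (negPf S0). Qed.

Definition Cay : sgraph := SGraph cayley_sym cayley_irrefl.

End Cayley.

Section GraphH.

Variables (r : nat) (f : {poly 'Z_4}).

Definition G1elts : {set GR f} := [set val u | u : {unit GR f} in G1 r f].

Definition H_set : {set GR f} := G1elts :|: [set - x | x in G1elts].

Lemma H_set0 : 0 \notin H_set.
Proof.
have G0 : 0 \notin G1elts.
  apply/imsetP => -[u _ u0].
  by have := valP u; rewrite /= -u0 unitr0.
rewrite inE negb_or G0 /=; apply: contra G0 => /imsetP[x xG /eqP].
by rewrite eq_sym oppr_eq0 => /eqP <-.
Qed.

Lemma H_setN (x : GR f) : (- x \in H_set) = (x \in H_set).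
Proof.
rewrite !inE orbC; congr (_ || _); first by rewrite mem_imset //; apply: oppr_inj.
by rewrite -{2}[x]opprK mem_imset //; apply: oppr_inj.
Qed.

Definition H4 : sgraph := Cay H_set0 H_setN.

End GraphH.

(* Main.v *)
Require Import Defs.
From HB Require Import structures.
From mathcomp Require Import all_boot all_order all_fingroup all_algebra.
From mathcomp Require Import cyclic pgroup nilpotent hall ring.
Set Implicit Arguments.
Unset Strict Implicit.
Unset Printing Implicit Defensive.
Import Order.TTheory GRing.Theory Num.Theory.
Local Open Scope ring_scope.

(** Let R be the Galois ring, K = 2R (which is also the annihilator of 2) and
    T = {0} + G1 the Teichmueller set. If t1 - t2 = t3 - t4 in T, write
    ti = si^2 with si in T. Then s1 + s4 = s2 + s3 modulo 2; squaring this
    congruence gives s1 s4 = s2 s3 modulo 2, so (s1 - s2)(s1 - s3) is in K and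
    s1 is s2 or s3. By counting, every element outside K is then exactly one
    difference of elements of T, i.e. T is a relative difference set.

    Let M v (x) = \sum_(t in T) v (x + t). Expanding in autocorrelations, for v
    of sum zero, |M v|^2 = 2^r |v|^2 - \sum_(h in K) <v (. + h), v>, and the last
    sum is nonnegative since K is a subgroup. The adjacency operator is
    M + M^* - 2, so the parallelogram law gives |mu + 2| <= 2 * 2^(r/2) for every
    eigenvalue mu other than the degree. The same identity shows M v = 0 when v
    is moreover K-invariant, which produces the eigenvalue -2. *)

(** * Autocorrelation and relative difference sets in finite abelian groups *)

Lemma sum_norm_sqr_gt0 (C : numClosedFieldType) (I : finType) (v : I -> C) i :
  v i != 0 -> 0 < \sum_j `|v j| ^+ 2.
Proof.
move=> vi0; rewrite lt_neqAle sumr_ge0 ?andbT => [|j _]; last exact: exprn_ge0.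
rewrite eq_sym psumr_neq0 => [|j _]; last exact: exprn_ge0.
by apply/hasP; exists i; rewrite ?mem_index_enum //= exprn_gt0 ?normr_gt0.
Qed.

Section Autocorrelation.

Variables (C : numClosedFieldType) (V : finZmodType).
Implicit Types (v : V -> C) (A K T : {set V}).

Definition autocorr v (h : V) : C := \sum_x v (x + h) * (v x)^*.

Lemma autocorr0 v : autocorr v 0 = \sum_x `|v x| ^+ 2.
Proof. by apply: eq_bigr => x _; rewrite addr0 normCK. Qed.

Lemma sum_autocorr v : \sum_h autocorr v h = `|\sum_x v x| ^+ 2.
Proof.
rewrite exchange_big normCK rmorph_sum big_distrlr [RHS]exchange_big /=.
by apply: eq_bigr => x _; rewrite [RHS](reindex_inj (addrI x)).
Qed.

Lemma sum_sqr_translates v A :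
  \sum_x `|\sum_(a in A) v (x + a)| ^+ 2 =
  \sum_(s in A) \sum_(t in A) autocorr v (s - t).
Proof.
under eq_bigr => x _ do rewrite normCK rmorph_sum big_distrlr /=.
rewrite exchange_big; apply: eq_bigr => s _.
rewrite exchange_big; apply: eq_bigr => t _.
rewrite (reindex_inj (addIr (- t))); apply: eq_bigr => x _.
by rewrite addrNK addrAC addrA.
Qed.

(** Each element of [K] is the difference of [#|K|] pairs from [K], so [#|K|] times this sum is the
    sum of squares in [sum_sqr_translates]. *)
Lemma sum_autocorr_subgroup_ge0 v K :
  0 \in K -> {in K &, forall s t, s - t \in K} ->
  0 <= \sum_(h in K) autocorr v h.
Proof.
move=> K0 KB.
have KE t h : t \in K -> (h + t \in K) = (h \in K).
  move=> Kt; apply/idP/idP => Kh; first by rewrite -(addrK t h) KB.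
  by rewrite -(opprK t) KB // -sub0r KB.
have: 0 <= #|K|%:R * \sum_(h in K) autocorr v h.
  rewrite mulr_natl -sumr_const.
  suff -> : \sum_(t in K) \sum_(h in K) autocorr v h =
            \sum_x `|\sum_(a in K) v (x + a)| ^+ 2.
    by apply: sumr_ge0 => x _; rewrite exprn_ge0.
  rewrite sum_sqr_translates [RHS]exchange_big; apply: eq_bigr => t Kt.
  rewrite [RHS](reindex_inj (addIr t)) /=.
  by apply: eq_big => [h|h _]; rewrite ?KE ?addrK.
by rewrite pmulr_rge0 // ltr0n card_gt0; apply/set0Pn; exists 0.
Qed.

(* Every element outside K is the difference of exactly one pair of elements of T;
   existence is encoded by the cardinality condition. *)
Definition rel_diff_set K T :=
  [/\ {in T &, forall s t, s - t \in K -> s = t},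
      {in T & T, forall s t, {in T & T, forall s' t',
         s - t = s' - t' -> s != t -> s = s'}}
    & #|~: K| = (#|T| * #|T|.-1)%N].

(** Differences of distinct elements of [T] avoid [K] and determine their pair; the cardinality
    clause then makes them fill the complement of [K]. The diagonal pairs give the term in [g 0]. *)
Lemma rel_diff_set_sum K T (g : V -> C) : 0 \in K -> rel_diff_set K T ->
  \sum_(s in T) \sum_(t in T) g (s - t) =
  #|T|%:R * g 0 + \sum_(h in ~: K) g h.
Proof.
move=> K0 [TK Tinj cardK].
pose D := [set p in setX T T | p.1 != p.2].
pose d (p : V * V) := p.1 - p.2.
have d_inj : {in D &, injective d}.
  move=> [s t] [s' t']; rewrite !inE /= => /andP[/andP[Ts Tt] st].
  move=> /andP[/andP[Ts' Tt'] _] E.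
  have ss' := Tinj _ _ Ts Tt _ _ Ts' Tt' E st.
  by move: E; rewrite /d /= -ss' => /addrI/oppr_inj <-.
have sumD (W : nmodType) (F : V * V -> W) :
    \sum_(p in D) F p = \sum_(s in T) \sum_(t in T :\ s) F (s, t).
  rewrite pair_big_dep /=; apply: eq_big => [[s t]|[s t] _] //=.
  by rewrite !inE /= eq_sym -andbA [_ && (t \in T)]andbC.
have cardD : #|D| = (#|T| * #|T|.-1)%N.
  rewrite -sum1_card (sumD nat) -sum_nat_const; apply: eq_bigr => s Ts.
  by rewrite sum1_card (cardsD1 s T) Ts.
have DK : d @: D = ~: K.
  apply/eqP; rewrite eqEcard cardK -cardD card_in_imset // leqnn andbT.
  apply/subsetP => _ /imsetP[[s t] Dst ->]; rewrite inE /d /=.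
  move: Dst; rewrite !inE /= => /andP[/andP[Ts Tt] st].
  by apply: contra st => sK; apply/eqP/TK.
rewrite -DK big_imset //= sumD mulr_natl -sumr_const -big_split /=.
by apply: eq_bigr => s Ts; rewrite (big_setD1 s) //= subrr.
Qed.

(** As [v] has sum zero, all autocorrelations together sum to zero; hence the complement of [K]
    contributes the opposite of what [K] does. *)
Lemma rel_diff_set_sum_sqr K T v :
  0 \in K -> rel_diff_set K T -> \sum_x v x = 0 ->
  \sum_x `|\sum_(t in T) v (x + t)| ^+ 2 =
  #|T|%:R * \sum_x `|v x| ^+ 2 - \sum_(h in K) autocorr v h.
Proof.
move=> K0 TK v0; rewrite sum_sqr_translates (rel_diff_set_sum _ K0 TK).
rewrite autocorr0; congr (_ + _); apply/eqP; rewrite -addr_eq0 addrC.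
under [X in _ + X]eq_bigl do rewrite inE.
by rewrite -(bigID (mem K) xpredT) sum_autocorr v0 normr0 expr0n.
Qed.

Lemma rel_diff_set_bound K T v :
  0 \in K -> {in K &, forall s t, s - t \in K} -> rel_diff_set K T ->
  \sum_x v x = 0 ->
  \sum_x `|\sum_(t in T) v (x + t)| ^+ 2 <= #|T|%:R * \sum_x `|v x| ^+ 2.
Proof.
move=> K0 KB TK v0; rewrite (rel_diff_set_sum_sqr K0 TK v0) gerDl oppr_le0.
exact: sum_autocorr_subgroup_ge0.
Qed.

(** Invariance makes every autocorrelation on [K] equal to the one at 0, so the right-hand side of
    [rel_diff_set_sum_sqr] cancels and a sum of squares vanishes. *)
Lemma rel_diff_set_invariant K T v :
  0 \in K -> rel_diff_set K T -> #|T| = #|K| -> \sum_x v x = 0 ->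
  (forall x, {in K, forall h, v (x + h) = v x}) ->
  forall x, \sum_(t in T) v (x + t) = 0.
Proof.
move=> K0 TK cardT v0 vK x; apply/eqP; rewrite -normr_eq0 -sqrf_eq0.
have /eqP := rel_diff_set_sum_sqr K0 TK v0.
rewrite [X in _ - X](eq_bigr (fun=> \sum_x `|v x| ^+ 2)) => [|h Kh]; last first.
  by rewrite -autocorr0; apply: eq_bigr => y _; rewrite addr0 vK.
rewrite sumr_const cardT mulr_natl subrr.
by rewrite psumr_eq0 => [/allP/(_ x)|y _]; rewrite ?mem_index_enum ?exprn_ge0 //; apply.
Qed.

End Autocorrelation.

Lemma rel_diff_set_eigenvalue (C : numClosedFieldType) (V : finZmodType)
    (K T : {set V}) (v : V -> C) (m : C) :
  0 \in K -> {in K &, forall s t, s - t \in K} -> rel_diff_set K T ->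
  \sum_x v x = 0 -> (exists x, v x != 0) ->
  (forall x, \sum_(t in T) v (x + t) + \sum_(t in T) v (x - t) = m * v x) ->
  `|m| <= 2 * sqrtC #|T|%:R.
Proof.
move=> K0 KB TK v0 [x0 vx0] vm.
pose N := \sum_x `|v x| ^+ 2.
have N_gt0 : 0 < N by apply: sum_norm_sqr_gt0 vx0.
have bp := rel_diff_set_bound K0 KB TK v0.
(* Translates by [- t] reduce to translates by [t] for the function [x |-> v (- x)]. *)
have bm : \sum_x `|\sum_(t in T) v (x - t)| ^+ 2 <= #|T|%:R * N.
  rewrite /N (reindex_inj oppr_inj) [X in _ * X](reindex_inj oppr_inj) /=.
  under eq_bigr => x _ do under eq_bigr => t _ do rewrite -opprD.
  apply: (rel_diff_set_bound (v := fun x => v (- x)) K0 KB TK).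
  by rewrite -[RHS]v0 [RHS](reindex_inj oppr_inj).
rewrite -(@ler_sqr _ `|m|) ?nnegrE ?mulr_ge0 ?sqrtC_ge0 ?ler0n //.
rewrite exprMn sqrtCK -(ler_pM2r N_gt0) {1}/N mulr_sumr.
have -> : 2 ^+ 2 * #|T|%:R * N = 2 * (#|T|%:R * N + #|T|%:R * N).
  by ring.
apply: le_trans (ler_wpM2l (ler0n _ 2) (lerD bp bm)).
rewrite -big_split mulr_sumr /=; apply: ler_sum => x _.
rewrite -exprMn -normrM -vm.
set a := \sum_(t in T) _; set b := \sum_(t in T) _.
rewrite -subr_ge0.
suff -> : 2 * (`|a| ^+ 2 + `|b| ^+ 2) - `|a + b| ^+ 2 = `|a - b| ^+ 2.
  exact: exprn_ge0.
rewrite !normCK !(rmorphD, rmorphN) /=.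
by ring.
Qed.

(** * The Teichmueller set, from an axiomatic description of the Galois ring *)

Section Teichmuller.

Variables (R : finComUnitRingType) (r : nat).
Hypotheses (cardR : #|R| = (4 ^ r)%N).
Hypothesis torsion2 : forall x : R, 2 * x = 0 -> exists c, x = 2 * c.
Hypothesis unit2 : forall x : R, (x \is a GRing.unit) = (2 * x != 0).
Hypothesis R4 : 4%:R = 0 :> R.

Definition tors2 := [set x : R | 2 * x == 0].

Lemma tors2P x : reflect (exists c, x = 2 * c) (x \in tors2).
Proof.
rewrite inE; apply: (iffP eqP) => [/torsion2 //|[c ->]].
by rewrite mulrA -natrM R4 mul0r.
Qed.

Lemma tors2_0 : 0 \in tors2. Proof. by rewrite inE mulr0. Qed.

Lemma tors2B : {in tors2 &, forall x y, x - y \in tors2}.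
Proof. by move=> x y; rewrite !inE mulrBr => /eqP-> /eqP->; rewrite subrr. Qed.

Lemma tors2N x : (- x \in tors2) = (x \in tors2).
Proof. by rewrite !inE mulrN oppr_eq0. Qed.

Lemma tors2D : {in tors2 &, forall x y, x + y \in tors2}.
Proof. by move=> x y Kx Ky; rewrite -[y]opprK tors2B ?tors2N. Qed.

(** This is primality of the ideal [tors2]: a unit factor cancels, and a nonunit is itself killed by
    2. *)
Lemma tors2M x y : (x * y \in tors2) = (x \in tors2) || (y \in tors2).
Proof.
have [ux|] := boolP (x \is a GRing.unit).
  have := ux; rewrite unit2 !inE => /negPf ->.
  by rewrite mulrCA (mulrI_eq0 _ (mulrI ux)).
by rewrite unit2 negbK !inE mulrA => /eqP ->; rewrite mul0r eqxx.
Qed.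

(** Doubling maps the ring onto [tors2], and its fibres are cosets of its kernel, again [tors2]; so
    the square of [#|tors2|] is [#|R|]. *)
Lemma card_tors2 : #|tors2| = (2 ^ r)%N.
Proof.
have cK : (#|tors2| * #|tors2| = #|R|)%N.
  rewrite -[RHS]sum1_card (partition_big (fun x : R => 2 * x) (mem tors2)) /=; last first.
    by move=> x _; apply/tors2P; exists x.
  rewrite -sum_nat_const; apply: eq_bigr => _ /tors2P[c ->].
  rewrite sum1_card -(card_imset _ (addrI c)); apply: eq_card => y.
  rewrite [RHS]inE; apply/imsetP/eqP => [[x]|yc].
    by rewrite inE => /eqP x0 ->; rewrite mulrDr x0 addr0.
  exists (y - c); last by rewrite addrC subrK.
  by rewrite inE mulrBr yc subrr.
by apply/eqP; rewrite -(eqn_exp2r _ _ (isT : 0 < 2)%N) -expnM mulnC expnM -mulnn cK cardR.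
Qed.

Lemma card_setC_tors2 : #|~: tors2| = (2 ^ r * (2 ^ r).-1)%N.
Proof.
apply/eqP; rewrite -subn1 -(eqn_add2l #|tors2|) cardsC card_tors2 cardR mulnBr muln1 -expnD.
by rewrite subnKC ?leq_exp2l ?leq_addr // addnn -mul2n expnM.
Qed.

Lemma card_units : #|[set: {unit R}]| = (2 ^ r * (2 ^ r - 1))%N.
Proof.
rewrite cardsT card_sub subn1 -card_setC_tors2.
by apply: eq_card => x; rewrite !inE -unit2.
Qed.

(** [2 ^ r - 1] is the odd part of the order of the unit group, hence the order of its Hall subgroup
    for the odd primes. *)
Lemma exists_odd_part : exists G : {group {unit R}}, #|G| = (2 ^ r - 1)%N.
Proof.
have abU : abelian [set: {unit R}].
  by apply/centsP => x _ y _; apply/val_inj/mulrC.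
(* For [r = 0] the formula for its order would make the unit group empty. *)
have [r0|r_gt0] := posnP r.
  have := card_units; rewrite r0 => c1.
  by have := cardG_gt0 [set: {unit R}]; rewrite c1.
have [G hG] := Hall_exists 2%N^' (abelian_sol abU).
exists G; rewrite (card_Hall hG) card_units partnM ?expn_gt0 ?subn_gt0 ?(ltn_exp2l 0) //.
rewrite part_p'nat ?mul1n ?part_pnat_id //.
- by rewrite p'natE //= dvdn2 oddB ?expn_gt0 // oddX; case: (r) r_gt0.
- by rewrite pnatNK pnatX.
Qed.

Variable G : {group {unit R}}.
Hypotheses (r_gt0 : (0 < r)%N) (cardG : #|G| = (2 ^ r - 1)%N).

Definition teich : {set R} := 0 |: [set val u | u in G].

Lemma odd_cardG : odd #|G|.
Proof. by rewrite cardG oddB ?expn_gt0 // oddX; case: (r) r_gt0. Qed.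

Lemma card_teich : #|teich| = (2 ^ r)%N.
Proof.
rewrite cardsU1 card_imset; last exact: val_inj.
rewrite cardG; case: imsetP => [[u _ /esym u0]|_].
  by have := valP u; rewrite /= u0 unitr0.
by rewrite addnC subnK ?expn_gt0.
Qed.

(** Squaring is bijective on a group of odd order, with inverse the power [(#|G| + 1) / 2]. *)
Lemma teich_sqrt t : t \in teich -> exists2 s, s \in teich & t = s ^+ 2.
Proof.
case/setU1P => [->|/imsetP[u Gu ->]]; first by exists 0; rewrite ?setU11 ?expr0n.
have /= uE : (u ^+ (#|G|.+1./2) ^+ 2 = u)%g.
  by rewrite -expgM muln2 odd_uphalfK ?odd_cardG // expgS expg_cardG // mulg1.
exists (val (u ^+ (#|G|.+1./2))%g); last by rewrite -{1}uE.
by rewrite setU1r // imset_f // groupX.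
Qed.

Lemma teich_tors2_eq0 t : t \in teich -> t \in tors2 -> t = 0.
Proof.
case/setU1P => [//|/imsetP[u _ ->]]; rewrite inE => /eqP Ku.
by have := valP u; rewrite unit2 Ku eqxx.
Qed.

Lemma teich_inj_mod : {in teich &, forall s t, s - t \in tors2 -> s = t}.
Proof.
move=> s t; have [-> T0 Tt|s0] := eqVneq s 0.
  by rewrite sub0r (tors2N t) => /(teich_tors2_eq0 Tt).
have [-> Ts T0|t0] := eqVneq t 0; first by rewrite subr0 => /(teich_tors2_eq0 Ts).
case/setU1P => [/eqP|/imsetP[u Gu ->]]; first by rewrite (negPf s0).
case/setU1P => [/eqP|/imsetP[w Gw ->]]; first by rewrite (negPf t0).
move=> /tors2P[c uwc]; congr (val _); apply/eqP; rewrite eq_mulgV1.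
have Gz : (u * w^-1)%g \in G by rewrite groupM ?groupV.
rewrite -order_eq1; apply/eqP.
(* [u / w = 1 + 2 d] squares to [1], but its order is odd. *)
have z2 : ((u * w^-1) ^+ 2 = 1)%g.
  apply: val_inj => /=.
  have uE : val u = val w + 2 * c by rewrite -uwc addrC subrK.
  have wE : val w * (val w)^-1 = 1 by rewrite mulrV // (valP w).
  set w' := (val w)^-1 in wE *.
  have -> : val u * w' * (val u * w') = (val w * w') ^+ 2 + 4 * (c * w' * (val w * w' + c * w')).
    by rewrite uE; ring.
  by rewrite R4 mul0r addr0 wE expr1n.
apply/eqP; rewrite -dvdn1 -(eqP (_ : coprime 2 #|G|)); last first.
  by rewrite coprime2n odd_cardG.
by rewrite dvdn_gcd order_dvdG // order_dvdn z2 eqxx.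
Qed.

Lemma teich_diff_inj : {in teich & teich, forall s t, {in teich & teich, forall s' t',
         s - t = s' - t' -> s != t -> s = s'}}.
Proof.
move=> _ _ /teich_sqrt[s1 T1 ->] /teich_sqrt[s2 T2 ->].
move=> _ _ /teich_sqrt[s3 T3 ->] /teich_sqrt[s4 T4 ->] E ne.
have E0 : s1 ^+ 2 - s2 ^+ 2 - (s3 ^+ 2 - s4 ^+ 2) = 0 by rewrite E subrr.
set D := (s1 + s4) - (s2 + s3).
have sumK : D \in tors2.
  suff: D ^+ 2 \in tors2 by rewrite expr2 tors2M // orbb.
  apply/tors2P.
  (* Once [s1 ^+ 2 + s4 ^+ 2] is replaced by [s2 ^+ 2 + s3 ^+ 2], every term of [D ^+ 2] has a
     factor 2. Adding the zero of [E0] leaves a polynomial identity for [ring]. *)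
  exists (s2 ^+ 2 + s3 ^+ 2 + s1 * s4 + s2 * s3 - (s1 + s4) * (s2 + s3)).
  by rewrite -[RHS]addr0 -E0 /D; ring.
have prodK : s1 * s4 - s2 * s3 \in tors2.
  (* By [E0] the left side is [(s1 + s4) ^+ 2 - (s2 + s3) ^+ 2], which has [D] as a factor; writing
     [D = 2 * c] makes it a multiple of 4. *)
  rewrite inE; have -> : 2 * (s1 * s4 - s2 * s3) = D ^+ 2 + 2 * D * (s2 + s3).
    by rewrite -[LHS]addr0 -E0 /D; ring.
  have /tors2P[c ->] := sumK.
  have -> : (2 * c) ^+ 2 + 2 * (2 * c) * (s2 + s3) = 4 * (c ^+ 2 + c * (s2 + s3)) by ring.
  by rewrite R4 mul0r.
have : (s1 - s2) * (s1 - s3) \in tors2.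
  have -> : (s1 - s2) * (s1 - s3) = s1 * D - (s1 * s4 - s2 * s3) by rewrite /D; ring.
  by apply: tors2B => //; rewrite tors2M // sumK orbT.
rewrite tors2M // => /orP[/(teich_inj_mod T1 T2) s12|/(teich_inj_mod T1 T3) -> //].
by rewrite s12 eqxx in ne.
Qed.

Lemma teich_rel_diff_set : rel_diff_set tors2 teich.
Proof.
split; [exact: teich_inj_mod | exact: teich_diff_inj |].
by rewrite card_teich card_setC_tors2.
Qed.

(** If [x = - y], then [x - y] is a multiple of 2, so [x = y] by [teich_inj_mod] and [2 * y = 0],
    impossible for a unit. *)
Lemma oppr_unit_group_disjoint :
  [disjoint [set val u | u in G] & [set - x | x in [set val u | u in G]]].
Proof.
apply/pred0P => x /=; apply/negP => /andP[xG /imsetP[y yG xy]].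
have y2_tors : y + y \in tors2 by rewrite inE mulrDr -mulrDl -natrD R4 mul0r.
have : x = y.
  by apply: teich_inj_mod; rewrite ?setU1r // xy -opprD tors2N.
rewrite xy => /eqP; rewrite -subr_eq0 -opprD oppr_eq0 -mulr2n -mulr_natl => y2.
by case/imsetP: yG y2 => u _ -> ; apply/negP; rewrite -unit2 (valP u).
Qed.

End Teichmuller.

(** * Reduction modulo 2 and lifting of coefficients *)

Lemma red2_zmod_morphism : zmod_morphism red2.
Proof.
by case=> [[|[|[|[|//]]]] ?] [[|[|[|[|//]]]] ?]; apply/eqP.
Qed.

Lemma red2_monoid_morphism : monoid_morphism red2.
Proof.
by split=> // -[[|[|[|[|//]]]] ?] [[|[|[|[|//]]]] ?]; apply/eqP.
Qed.

HB.instance Definition _ :=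
  GRing.isZmodMorphism.Build 'Z_4 'F_2 red2 red2_zmod_morphism.
HB.instance Definition _ :=
  GRing.isMonoidMorphism.Build 'Z_4 'F_2 red2 red2_monoid_morphism.

Lemma red2_eq0 (a : 'Z_4) : (red2 a == 0) = (2 * a == 0).
Proof. by case: a => [[|[|[|[|//]]]] ?]. Qed.

Definition half4 (a : 'Z_4) : 'Z_4 := (a : nat)./2%:R.

Definition lift2 (a : 'F_2) : 'Z_4 := (a : nat)%:R.

Lemma half4K (a : 'Z_4) : red2 a = 0 -> 2 * half4 a = a.
Proof. by move/eqP; case: a => [[|[|[|[|//]]]] ?] //= _; apply/eqP. Qed.

Lemma lift2K : cancel lift2 red2.
Proof. by case=> [[|[|//]] ?]; apply/eqP. Qed.

Lemma map_red2_eq0 (p : {poly 'Z_4}) :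
  map_poly red2 p = 0 -> exists h, p = 2 * h.
Proof.
move=> /polyP p0; exists (map_poly half4 p); apply/polyP => i.
rewrite mulr_natl coefMn coef_map_id0; last exact/eqP.
by rewrite -mulr_natl half4K //; have := p0 i; rewrite coef_map coef0.
Qed.

Lemma map_red2_lift (q : {poly 'F_2}) : exists p, map_poly red2 p = q.
Proof.
exists (map_poly lift2 q); apply/polyP => i.
by rewrite coef_map coef_map_id0 /= ?lift2K //; apply/eqP.
Qed.

(** * Arithmetic of the Galois ring *)

Section GaloisRing.

Variables (r : nat) (f : {poly 'Z_4}).
Hypotheses (r_gt0 : (0 < r)%N) (fP : galois_poly r f).

(** The quotient is taken modulo [mk_monic f], which is a default polynomial unless [f] is monic and
    nonconstant; the latter comes from [r_gt0]. *)
Lemma mk_monic_galois : mk_monic f = f.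
Proof. by case: fP => fm sf _; rewrite /mk_monic sf fm ltnS r_gt0. Qed.

Definition to_GR (p : {poly 'Z_4}) : GR f := in_qpoly f p.

Lemma to_GRD p q : to_GR (p + q) = to_GR p + to_GR q.
Proof. exact: in_qpolyD. Qed.

Lemma to_GRM p q : to_GR (p * q) = to_GR p * to_GR q.
Proof. exact: in_qpolyM. Qed.

Lemma to_GR1 : to_GR 1 = 1.
Proof. exact: in_qpoly1. Qed.

Lemma to_GR_nat n : to_GR n%:R = n%:R.
Proof.
elim: n => [|n IH]; first exact: in_qpoly0.
by rewrite !mulrS to_GRD to_GR1 IH.
Qed.

Lemma to_GR_f : to_GR f = 0.
Proof.
apply: val_inj => /=; rewrite mk_monic_galois.
by apply: Pdiv.RingMonic.rmodpp; case: fP.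
Qed.

Lemma to_GRK (x : GR f) : to_GR (val x) = x.
Proof. by apply: val_inj; apply: in_qpoly_small; apply: size_mk_monic. Qed.

Lemma card_GR : #|{: GR f}| = (4 ^ r)%N.
Proof.
case: fP => fm sf _.
by have := card_monic_qpoly (h := f); rewrite sf card_ord; apply.
Qed.

Lemma GR4 : 4 = 0 :> GR f.
Proof.
have <- : to_GR 4 = 4 by exact: to_GR_nat.
have -> : 4 = 0 :> {poly 'Z_4} by rewrite -polyC_natr; congr (_%:P); apply/eqP.
exact: in_qpoly0.
Qed.

(** The representative of [2 * x] is twice that of [x], with no reduction by [f], so the condition
    is read off coefficient by coefficient. *)
Lemma GR_double_eq0 (x : GR f) : (2 * x == 0) = (map_poly red2 (val x) == 0).
Proof.
have dx : val (2 * x) = 2 * val x by rewrite mulr_natl mulr2n mulr_natl mulr2n.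
rewrite -(inj_eq val_inj) dx; apply/eqP/eqP => /polyP x0; apply/polyP => i.
  rewrite coef_map coef0; apply/eqP; rewrite red2_eq0.
  by have := x0 i; rewrite mulr_natl coefMn coef0 => xi; rewrite mulr_natl xi.
have /eqP := x0 i; rewrite coef_map !coef0 red2_eq0 mulr_natl => /eqP xi.
by rewrite mulr_natl coefMn.
Qed.

Lemma GR_torsion2 (x : GR f) : 2 * x = 0 -> exists c, x = 2 * c.
Proof.
move/eqP; rewrite GR_double_eq0 => /eqP/map_red2_eq0[h xh].
by exists (to_GR h); rewrite -[LHS]to_GRK xh to_GRM to_GR_nat.
Qed.

(** If [2 * x] is nonzero, the reduction of [x] is nonzero, of degree below that of the irreducible
    reduction of [f]; a Bezout identity modulo 2 then lifts to an inverse of [x] modulo 2. *)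
Lemma GR_unit (x : GR f) : (x \is a GRing.unit) = (2 * x != 0).
Proof.
apply/idP/idP => [ux|].
  apply/eqP => x2; have /eqP : (2 : GR f) = 0 by rewrite -(mulrK ux 2) x2 mul0r.
  rewrite -[2 as X in X == _]mulr1 GR_double_eq0.
  by rewrite [val _]/= rmorph1 oner_eq0.
rewrite GR_double_eq0 => x0.
case: fP => fm sf fbar_irr.
have cop : coprimep (map_poly red2 f) (map_poly red2 (val x)).
  rewrite irreducible_poly_coprime //.
  apply/negP => /(dvdp_leq x0); apply/negP; rewrite -ltnNge.
  apply: leq_ltn_trans (size_poly _ _) _.
  rewrite size_map_poly_id0 ?(monicP fm) ?rmorph1 ?oner_eq0 //.
  by rewrite -[in X in (_ < X)%N]mk_monic_galois size_mk_monic.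
have /Bezout_eq1_coprimepP[[u v] /= uv] := cop.
have [U Uu] := map_red2_lift u; have [W Wv] := map_red2_lift v.
have [h hE] : exists h, U * f + W * val x - 1 = 2 * h.
  apply: map_red2_eq0.
  by rewrite !(rmorphB, rmorphD, rmorphM, rmorph1) /= Uu Wv uv subrr.
have WxE : to_GR W * x = 1 + 2 * to_GR h.
  have : to_GR (U * f + W * val x) = to_GR (1 + 2 * h) by rewrite -hE [1 + _]addrC subrK.
  by rewrite 2!to_GRD !to_GRM to_GR1 to_GR_nat to_GR_f to_GRK mulr0 add0r.
(* [1 + 2 * to_GR h] is its own inverse because [4 = 0]. *)
apply/unitrP; exists (to_GR W * (1 + 2 * to_GR h)).
suff E : to_GR W * (1 + 2 * to_GR h) * x = 1 by rewrite [x * _]mulrC.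
rewrite mulrAC WxE.
have -> : (1 + 2 * to_GR h) * (1 + 2 * to_GR h) = 1 + 4 * (to_GR h + to_GR h ^+ 2).
  by ring.
by rewrite GR4 mul0r addr0.
Qed.

End GaloisRing.

(** * Spectra of finite graphs *)

(** Passes from row vectors indexed by ordinals to functions on vertices; symmetry of [adj] turns
    the row action into a sum over neighbours. *)
Lemma eigenvalue_adjmxP (C : numClosedFieldType) (G : sgraph) (mu : C) :
  eigenvalue (adjmx C G) mu <->
  exists2 v : vertex G -> C, exists x, v x != 0 &
    forall x, \sum_(y | adj x y) v y = mu * v x.
Proof.
have sumE (w : vertex G -> C) x :
    \sum_(i < #|vertex G|) w (enum_val i) * (adj (enum_val i) x)%:R = \sum_(y | adj x y) w y.
  rewrite [RHS]big_mkcond /= [RHS](reindex (fun i : 'I_#|vertex G| => enum_val i)) /=.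
    by apply: eq_bigr => i _; rewrite adj_sym; case: (adj _ _); rewrite ?mulr1 ?mulr0.
  exact/onW_bij/enum_val_bij.
split=> [/eigenvalueP[v vA v0]|[v [x0 vx0] vA]].
  exists (fun x => v 0 (enum_rank x)).
    have [j vj] : exists j, v 0 j != 0 by apply/rV0Pn.
    by exists (enum_val j); rewrite enum_valK.
  move=> x; rewrite -sumE; have /rowP/(_ (enum_rank x)) := vA.
  rewrite !mxE => <-; apply: eq_bigr => i _.
  by rewrite !mxE enum_valK enum_rankK.
apply/eigenvalueP; exists (\row_i v (enum_val i)).
  apply/rowP => j; rewrite !mxE -vA -sumE.
  by apply: eq_bigr => i _; rewrite !mxE.
by apply/rV0Pn; exists (enum_rank x0); rewrite mxE enum_rankK.
Qed.

(** By symmetry of [adj], the Hermitian form of the adjacency matrix at [v] is its own conjugate,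
    and it equals [mu] times the positive real [N]. *)
Lemma eigenvalue_adjmx_real (C : numClosedFieldType) (G : sgraph) (mu : C) :
  eigenvalue (adjmx C G) mu -> mu \is Num.real.
Proof.
move=> /eigenvalue_adjmxP[v [x0 vx0] vA].
pose N := \sum_x `|v x| ^+ 2.
have N_gt0 : 0 < N by apply: sum_norm_sqr_gt0 vx0.
have muN : mu * N = \sum_x \sum_(y | adj x y) v y * (v x)^*.
  rewrite mulr_sumr; apply: eq_bigr => x _.
  by rewrite normCK mulrA -vA mulr_suml.
rewrite CrealE; apply/eqP/(mulIf (lt0r_neq0 N_gt0)); rewrite muN.
have -> : mu^* * N = (mu * N)^*.
  by rewrite rmorphM; congr (_ * _); apply/esym/eqP; rewrite -CrealE gtr0_real.
rewrite muN rmorph_sum.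
under eq_bigr => x _ do rewrite rmorph_sum.
rewrite (exchange_big_dep xpredT) //=; apply: eq_bigr => x _.
by apply: eq_big => [y|y _]; rewrite ?[adj y x]adj_sym // rmorphM /= conjCK mulrC.
Qed.

(** Summing the eigenvalue equation over all vertices multiplies the total of [v] by [d] on one side
    and by [mu] on the other. *)
Lemma regular_eigen_sum0 (C : numClosedFieldType) (G : sgraph) d (mu : C)
    (v : vertex G -> C) :
  regular G d -> (forall x, \sum_(y | adj x y) v y = mu * v x) ->
  mu != d%:R -> \sum_x v x = 0.
Proof.
move=> Gd vA mud; apply/eqP; move: mud; apply: contraNT => v0.
apply/eqP/(mulIf v0); rewrite !mulr_sumr.
under eq_bigr => x _ do rewrite -vA.
rewrite (exchange_big_dep xpredT) //=; apply: eq_bigr => x _.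
rewrite sumr_const -[in RHS](Gd x) mulr_natl; congr (_ *+ _).
by apply: eq_card => y; rewrite !inE adj_sym.
Qed.

(** The eigenvalues are the finitely many roots of the characteristic polynomial, and [mu] survives
    the removal of [d] and [- d]. Norms are real, hence comparable, so a maximum is attained. *)
Lemma is_lambda_exists (C : numClosedFieldType) (G : sgraph) d (mu : C) :
  eigenvalue (adjmx C G) mu -> mu != d%:R -> mu != - d%:R ->
  exists l : C, is_lambda G d l.
Proof.
move=> muA mud muNd.
have [p pE] : exists rs : seq C, forall x, eigenvalue (adjmx C G) x = (x \in rs).
  have [rs rsE] := closed_field_poly_normal (char_poly (adjmx C G)).
  exists rs => x; rewrite eigenvalue_root_char rsE.
  by rewrite (monicP (char_poly_monic _)) scale1r root_prod_XsubC.
pose s := [seq x <- p | (x != d%:R) && (x != - d%:R)].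
have max_norm (t : seq C) x : x \in t ->
    exists2 y, y \in t & forall z, z \in t -> `|z| <= `|y|.
  elim: t x => // a [|b t] IH x _.
    by exists a; rewrite ?mem_head // => z /[!inE] /eqP ->.
  have [y yt ymax] := IH b (mem_head _ _).
  have [ay|ya] := real_leP (normr_real a) (normr_real y).
    exists y; first by rewrite inE yt orbT.
    by move=> z; rewrite inE => /predU1P[-> //|]; apply: ymax.
  exists a; first exact: mem_head.
  move=> z; rewrite inE => /predU1P[-> //|/ymax zy].
  exact: le_trans zy (ltW ya).
have [|y] := max_norm s mu; first by rewrite mem_filter mud muNd -pE.
rewrite mem_filter -pE => /andP[/andP[yd yNd] yA] ymax.
exists `|y|; split; first by exists y.
by move=> z zA zd zNd; apply: ymax; rewrite mem_filter zd zNd -pE.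
Qed.

(** * Spectrum of the graph [H4] *)

Section MainGraph.

Variables (C : numClosedFieldType) (r : nat) (f : {poly 'Z_4}).
Hypotheses (r_gt0 : (0 < r)%N) (fP : galois_poly r f).

Let K := tors2 (GR f).
Let T := teich (G1 r f).
Let card_R := card_GR r_gt0 fP.
Let tors := @GR_torsion2 f.
Let unitE := GR_unit r_gt0 fP.
Let R4 := GR4 f.

(** [exists_odd_part] makes [pick] succeed, so the default trivial group is never returned. *)
Lemma card_G1 : #|G1 r f| = (2 ^ r - 1)%N.
Proof.
rewrite /G1; case: pickP => [G /eqP //|noG].
have [G cG] := exists_odd_part card_R tors unitE R4.
by have := noG G; rewrite cG eqxx.
Qed.

Lemma rel_diff_set_G1 : rel_diff_set K T.
Proof. exact: (teich_rel_diff_set card_R tors unitE R4 r_gt0 card_G1). Qed.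

Lemma disjoint_H : [disjoint G1elts r f & [set - x | x in G1elts r f]].
Proof. exact: (oppr_unit_group_disjoint tors unitE R4 r_gt0 card_G1). Qed.

Lemma card_H_set : #|H_set r f| = (2 ^ r.+1 - 2)%N.
Proof.
rewrite cardsU disjoint_setI0 ?disjoint_H // cards0 subn0.
rewrite (card_imset _ oppr_inj) card_imset; last exact: val_inj.
by rewrite card_G1 addnn -mul2n mulnBr -expnS.
Qed.

Lemma H4_regular : regular (H4 r f) (2 ^ r.+1 - 2)%N.
Proof.
move=> x; rewrite -card_H_set -[RHS](card_imset _ (@inj_comp _ _ _ _ _ (addrI x) oppr_inj)).
apply: eq_card => y; rewrite [LHS]inE; apply/idP/imsetP => [xy|[h Hh ->]].
  by exists (x - y) => //=; rewrite opprB addrC subrK.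
by rewrite /= /cayley_adj opprD opprK addNKr.
Qed.

(** The element 0 of [T], absent from [H_set], adds [v x] to each of the two sums; hence the
    correction [2 * v x]. *)
Lemma H4_adj_sum (v : GR f -> C) x :
  \sum_(y | @adj (H4 r f) x y) v y =
  \sum_(t in T) v (x + t) + \sum_(t in T) v (x - t) - 2 * v x.
Proof.
have T0 : 0 \notin G1elts r f.
  by apply: contra (H_set0 r f) => G0; rewrite inE G0.
rewrite !big_setU1 //= subr0 addr0.
rewrite (reindex_inj (@inj_comp _ _ _ _ _ (addrI x) oppr_inj)) /=.
under eq_bigl => h do rewrite /cayley_adj opprD opprK addNKr.
rewrite (eq_bigl [predU G1elts r f & [set - x | x in G1elts r f]]) => [|h]; last first.
  by rewrite !inE.
rewrite bigU ?disjoint_H // (big_imset _ (in2W oppr_inj)) /=.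
under [X in _ + X = _]eq_bigr => h _ do rewrite opprK.
by ring.
Qed.

Lemma H4_eigenvalue_bound (mu : C) :
  eigenvalue (adjmx C (H4 r f)) mu -> mu != (2 ^ r.+1 - 2)%N%:R ->
  `|mu + 2| <= 2 * sqrtC (2 ^+ r).
Proof.
move=> /eigenvalue_adjmxP[v v_neq0 vA] mud.
have v0 := regular_eigen_sum0 H4_regular vA mud.
rewrite -natrX -(card_teich card_G1).
apply: (rel_diff_set_eigenvalue (tors2_0 _) (@tors2B _) rel_diff_set_G1 v0 v_neq0).
by move=> x; rewrite mulrDl -vA H4_adj_sum subrK.
Qed.

(** Supplies the eigenvalue that [is_lambda_exists] asks for. The eigenvector is the difference of
    the indicators of the cosets [K] and [1 + K], which is [K]-invariant of sum zero. *)
Lemma H4_eigenvalueN2 : eigenvalue (adjmx C (H4 r f)) (- 2).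
Proof.
pose v (x : GR f) : C := (x \in K)%:R - (x - 1 \in K)%:R.
have K1 : 1 \notin K.
  by rewrite inE -unitE unitr1.
have v0 : \sum_x v x = 0.
  by rewrite sumrB [X in _ - X](reindex_inj (addIr 1)) /=;
    under [X in _ - X]eq_bigr do rewrite addrK; rewrite subrr.
have KD x h : h \in K -> (x + h \in K) = (x \in K).
  move=> Kh; apply/idP/idP => Kx; last exact: tors2D.
  by rewrite -(addrK h x) tors2B.
have vK x : {in K, forall h, v (x + h) = v x}.
  by move=> h Kh; rewrite /v addrAC !(KD _ h Kh).
have cT : #|T| = #|K|.
  by rewrite (card_teich card_G1) (card_tors2 card_R tors R4).
have Kz : 0 \in K := tors2_0 _.
apply: (proj2 (eigenvalue_adjmxP (H4 r f) _)); exists v.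
  by exists 0; rewrite /v Kz sub0r tors2N (negPf K1) subr0 oner_eq0.
move=> x; rewrite H4_adj_sum.
rewrite (rel_diff_set_invariant Kz rel_diff_set_G1 cT v0 vK).
have -> : \sum_(t in T) v (x - t) = 0.
  rewrite (eq_bigr (fun t => v (- (- x + t)))) => [|t _]; last by rewrite opprD opprK.
  apply: (rel_diff_set_invariant (v := fun x => v (- x)) Kz rel_diff_set_G1 cT).
    by rewrite -[RHS]v0 [RHS](reindex_inj oppr_inj).
  by move=> y h Kh; rewrite opprD vK // tors2N.
by rewrite addr0 sub0r mulNr.
Qed.

End MainGraph.

(* 2^(r/2+1) is written 2 * sqrtC (2 ^+ r). *)
Theorem theorem4p1 (C : numClosedFieldType) (r : nat) (f : {poly 'Z_4})
  (hr : (4 <= r)%N) (hf : galois_poly r f) :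
  [/\ ramanujan C (H4 r f) (2 ^ r.+1 - 2)%N,
      #|vertex (H4 r f)| = (4 ^ r)%N
    & forall mu : C, eigenvalue (adjmx C (H4 r f)) mu ->
        mu != (2 ^ r.+1 - 2)%N%:R ->
        - (2 * sqrtC (2 ^+ r)) - 2 <= mu <= 2 * sqrtC (2 ^+ r) + 2].
Proof.
have r_gt0 : (0 < r)%N by apply: leq_trans hr.
set s := sqrtC (2 ^+ r).
have s_ge0 : 0 <= s by rewrite sqrtC_ge0 exprn_ge0.
have s2 : s ^+ 2 = 2 ^+ r by rewrite sqrtCK.
(* [hr] gives [16 <= 2 ^ r]; the final quadratic estimate relies on this. *)
have s_ge4 : 4 <= s.
  rewrite -ler_sqr ?nnegrE // s2 -!natrX ler_nat.
  by rewrite (leq_pexp2l (isT : 0 < 2)%N hr).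
(* Keeps the eigenvalue [- 2] distinct from [- d]. *)
have d_gt2 : (2 < 2 ^ r.+1 - 2)%N.
  by rewrite ltn_subRL (@leq_trans (2 ^ 5)) // leq_exp2l.
split; last 1 first.
- move=> mu muA mud.
  have mu2_real : mu + 2 \is Num.real.
    by rewrite realD ?(eigenvalue_adjmx_real muA) ?realn.
  have := H4_eigenvalue_bound r_gt0 hf muA mud.
  rewrite real_ler_norml // -/s => /andP[lo hi].
  (* The lower endpoint is the exact shift of the bound on [mu + 2]; the upper one follows from the
     stronger [mu + 2 <= 2 * s]. *)
  rewrite lerBlDr lo; apply: le_trans (_ : mu + 2 <= _).
    by rewrite lerDl.
  by apply: le_trans hi _; rewrite lerDl.
- split; first exact: H4_regular.
  have [||l lP] := is_lambda_exists (d := (2 ^ r.+1 - 2)%N) (H4_eigenvalueN2 C r_gt0 hf).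
  + by rewrite lt_eqF // (lt_le_trans _ (ler0n _ _)) // oppr_lt0.
  + by rewrite eqr_opp eqr_nat ltn_eqF.
  exists l => //; case: lP => -[mu [muA mud _ ->]] _.
  have bmu := H4_eigenvalue_bound r_gt0 hf muA mud.
  have : `|mu| <= 2 * (s + 1).
    rewrite mulrDr mulr1 -{1}(addrK 2 mu).
    apply: le_trans (ler_normB _ _) _.
    by rewrite [`|2|]ger0_norm // lerD2r.
  move/le_trans; apply; rewrite ler_pM2l //.
  rewrite -ler_sqr ?nnegrE ?addr_ge0 // ?sqrtC_ge0; last first.
    by rewrite subr_ge0 ler1n subn_gt0 (ltn_exp2l 1).
  rewrite sqrtCK natrB; last by rewrite (leq_exp2l 1).
  rewrite natrX [2 ^+ r.+1]exprS -s2 -subr_ge0.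
  (* Here [d - 1 = 2 * s ^+ 2 - 3], and the bound to prove has become [(s + 1) ^+ 2 <= d - 1]. The
     difference is written so that [4 <= s] shows its sign. *)
  have -> : 2 * s ^+ 2 - 2 - 1 - (s + 1) ^+ 2 = (s - 4) * (s + 2) + 4 by ring.
  by rewrite addr_ge0 // mulr_ge0 ?subr_ge0 // addr_ge0.
- exact: card_GR.
Qed.
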